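(* For all $n\ge1$, $$\overline{\operatorname{Im}\Theta_{2,(1,1,1),n}}=\operatorname{Seg}_{(1,1,1),n}$$ as closed subvarieties of $(\mathbb{P}^1\times\mathbb{P}^1\times\mathbb{P}^1)^{\times n}$.
   Context: All varieties are complex algebraic varieties, and the bar denotes (Zariski) closure. Let $\mathbb{P}(\mathbb{C}^{2\times3})\cong\mathbb{P}^5$ be the projective space of nonzero $2\times3$ complex matrices up to scale. The flatland imaging map is the rational map $$\Theta_{2,(1,1,1),n}:(\mathbb{P}^2)^{\times n}\times\big(\mathbb{P}(\mathbb{C}^{2\times3})\big)^{\times3}\dashrightarrow(\mathbb{P}^1\times\mathbb{P}^1\times\mathbb{P}^1)^{\times n},\qquad (q_1,\ldots,q_n,A_1,A_2,A_3)\mapsto\big((A_1q_j,A_2q_j,A_3q_j)\mid 1\le j\le n\big),$$ which is defined where all $A_iq_j\neq0$. Let $\sigma_{(1,1,1)}:\mathbb{P}^1\times\mathbb{P}^1\times\mathbb{P}^1\to\mathbb{P}^7$ be the Segre embedding, $(p_1,p_2,p_3)\mapsto p_1\otimes p_2\otimes p_3$. The Segre-determinantal locus $\operatorname{Seg}_{(1,1,1),n}\subset(\mathbb{P}^1\times\mathbb{P}^1\times\mathbb{P}^1)^{\times n}$ is the smallest closed subvariety containing all $(P_1,\ldots,P_n)$ such that the points $\sigma_{(1,1,1)}(P_1),\ldots,\sigma_{(1,1,1)}(P_n)$ lie on some common hyperplane of $\mathbb{P}^7$. *)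

(* Defs.v *)
From HB Require Import structures.
From mathcomp Require Import all_boot all_order all_algebra.
From mathcomp Require Import mpoly complex.
From mathcomp Require Import classical_sets reals.

Set Implicit Arguments.
Unset Strict Implicit.
Unset Printing Implicit Defensive.

Import GRing.Theory.
Local Open Scope ring_scope.
Local Open Scope classical_set_scope.

Section Projective.
Variables (K : fieldType) (V : vectType K).

(* P(V) as the set of lines through the origin of V. *)
Record proj := Proj { line :> {vspace V}; _ : \dim line == 1%N }.

HB.instance Definition _ := [isSub for line].
HB.instance Definition _ := [Choice of proj by <:].

Lemma dim_vline_eq1 (v : V) : v != 0 -> \dim <[v]> == 1%N.
Proof. by rewrite dim_vline => ->. Qed.

Definition mkproj (v : V) (v0 : v != 0) : proj := Proj (dim_vline_eq1 v0).

(* Homogeneous coordinates of p: an arbitrary nonzero vector on the line p. The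
   notions built on [rep] below do not depend on the choice. *)
Definition rep (p : proj) : V := vpick p.

Lemma rep_neq0 (p : proj) : rep p != 0.
Proof. by case: p => U dU; rewrite /rep vpick0 -dimv_eq0 (eqP dU). Qed.

Lemma line_rep (p : proj) : <[rep p]>%VS = p.
Proof.
apply/eqP; rewrite eqEdim -memvE memv_pick /= dim_vline rep_neq0.
by case: p => U /= /eqP ->.
Qed.

Definition hyperplane (H : {vspace V}) : Prop := (\dim H).+1 = \dim {:V}.

End Projective.

Section Segre.
Variable K : fieldType.

Definition P1 : Type := proj 'cV[K]_2.

(* The coordinate (a, b, c) of a tensor is its coefficient on e_a (x) e_b (x) e_c,
   so that P(tensor) is P^7. *)
Definition tensor : vectType K := {ffun 'I_2 * 'I_2 * 'I_2 -> K^o}.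

Definition tensor3 (u v w : 'cV[K]_2) : tensor :=
  [ffun t => u t.1.1 0 * v t.1.2 0 * w t.2 0].

Lemma tensor3_neq0 (u v w : 'cV[K]_2) :
  u != 0 -> v != 0 -> w != 0 -> tensor3 u v w != 0.
Proof.
move=> /cV0Pn[a ua] /cV0Pn[b vb] /cV0Pn[c wc].
apply/eqP => /ffunP /(_ (a, b, c)); rewrite !ffunE /= => /eqP.
by rewrite !mulf_eq0 (negPf ua) (negPf vb) (negPf wc).
Qed.

Definition segre (p : 'I_3 -> P1) : proj tensor :=
  mkproj (tensor3_neq0 (rep_neq0 (p 0)) (rep_neq0 (p 1)) (rep_neq0 (p 2%:R))).

End Segre.

Section Flatland.
Variables (K : fieldType) (n : nat).

(* (P^1 x P^1 x P^1)^n; [P j i] is the i-th component of the j-th factor. *)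
Definition triples : Type := 'I_n -> 'I_3 -> P1 K.

(* The multihomogeneous coordinate ring of [triples]: the variable indexed by
   (j, i, a) is the a-th homogeneous coordinate of [P j i]. *)
Definition var : finType := ('I_n * 'I_3 * 'I_2)%type.
Definition coord_ring : Type := {mpoly K[#|var|]}.

Definition multihomogeneous (f : coord_ring) : Prop :=
  exists d : 'I_n -> 'I_3 -> nat, forall m : 'X_{1..#|var|}, m \in msupp f ->
    forall j i, (\sum_(a < 2) m (enum_rank ((j, i, a) : var)))%N = d j i.

Definition coords (P : triples) (k : 'I_#|var|) : K :=
  let: (j, i, a) := enum_val k in rep (P j i) a 0.

Definition zero_locus (S : set coord_ring) : set triples :=
  [set P | forall f, S f -> f.@[coords P] = 0].

Definition zariski_closed (Z : set triples) : Prop :=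
  exists2 S : set coord_ring, S `<=` multihomogeneous & Z = zero_locus S.

Definition zariski_closure (X : set triples) : set triples :=
  smallest zariski_closed X.

Definition theta_dom (q : 'I_n -> proj 'cV[K]_3)
    (A : 'I_3 -> proj 'M[K]_(2, 3)) : Prop :=
  forall j i, rep (A i) *m rep (q j) != 0.

Definition theta q A (qA : theta_dom q A) : triples :=
  fun j i => mkproj (qA j i).

Definition im_theta : set triples :=
  [set P | exists q A (qA : theta_dom q A), P = theta qA].

Definition seg_locus : set triples :=
  zariski_closure
    [set P | exists2 H : {vspace tensor K}, hyperplane H &
                forall j, (segre (P j) <= H)%VS].

End Flatland.

Arguments im_theta K n : clear implicits.
Arguments seg_locus K n : clear implicits.

(* Main.v *)
(* A hyperplane of P^7 is a nonzero trilinear form T on (K^2)^3, and a configuration lies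
   on it iff T vanishes at all its points. A configuration in the image satisfies such a
   form, the trifocal tensor of the cameras or, for degenerate cameras, a more special one.

   Conversely, let f be a multihomogeneous polynomial vanishing on the image, and let the
   points P_j lie on T = 0. By one-parameter polynomial deformations it is enough to prove
   f = 0 at the general member of a family through (P_j). First each P_j is moved along the
   hypersurface to a smooth point. Then T is deformed to a sum of two general cubes, each
   smooth P_j following it by solving a linear equation in one of its three factors; after
   that T(p1, p2, .) <> 0 at every point, so p3 is determined by (p1, p2), which can be moved
   freely. Finally T(u, w, .) = 0 for some u and w (a quadratic equation), and in coordinates
   adapted to u and w both the cameras and the points q_j can be written down. *)
From HB Require Import structures.
Require Import Defs.
From mathcomp Require Import all_boot all_order all_algebra.
From mathcomp Require Import mpoly complex ring.
From mathcomp Require Import boolp classical_sets reals spectral.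

Set Implicit Arguments.
Unset Strict Implicit.
Unset Printing Implicit Defensive.

Import GRing.Theory.
Local Open Scope ring_scope.
Local Open Scope classical_set_scope.

Lemma sum_ord2 (V : nmodType) (F : 'I_2 -> V) : \sum_a F a = F 0 + F 1.
Proof. by rewrite big_ord_recl big_ord1; congr (_ + F _); apply: val_inj. Qed.

Lemma ord2P (P : 'I_2 -> Prop) : P 0 -> P 1 -> forall a, P a.
Proof.
move=> P0 P1 [[|[|//]] a]; [move: P0 | move: P1]; congr P; exact: val_inj.
Qed.

Lemma ord3P (P : 'I_3 -> Prop) : P 0 -> P 1 -> P 2%:R -> forall i, P i.
Proof.
move=> P0 P1 P2 [[|[|[|//]]] a]; [move: P0 | move: P1 | move: P2];
  congr P; exact: val_inj.
Qed.

Lemma sum_ord3 (V : nmodType) (F : 'I_3 -> V) : \sum_i F i = F 0 + F 1 + F 2%:R.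
Proof.
rewrite 2!big_ord_recl big_ord1 addrA.
by congr (_ + F _ + F _); apply: val_inj.
Qed.

Definition triple (X : Type) (x y z : X) (i : 'I_3) : X :=
  if i == 0 then x else if i == 1 then y else z.

(** Equality of projective points, read on homogeneous coordinates. *)
Definition scaled (K : fieldType) (V : lmodType K) (u v : V) :=
  exists2 c, c != 0 & u = c *: v.

Lemma scaled_refl (K : fieldType) (V : lmodType K) (u : V) : scaled u u.
Proof. by exists 1; rewrite ?oner_eq0 ?scale1r. Qed.

(** * Trilinear forms on the plane *)

Section PlaneVectors.
Variable K : fieldType.
Implicit Types (u v w p s : 'cV[K]_2).

Lemma colP2 u v : u 0 0 = v 0 0 -> u 1 0 = v 1 0 -> u = v.
Proof. by move=> e0 e1; apply/colP; apply: ord2P. Qed.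

Lemma vec2_neq0 v : v != 0 -> v 0 0 != 0 \/ v 1 0 != 0.
Proof. by case/cV0Pn; apply: ord2P; [left | right]. Qed.

Definition dotp u v : K := u 0 0 * v 0 0 + u 1 0 * v 1 0.
(** A quarter turn: [dotp (perp u) v] is the determinant of [u] and [v], the bracket [u,v]. *)
Definition perp u : 'cV[K]_2 := \col_a (if a == 0 then - u 1 0 else u 0 0).

Lemma perp0E u : perp u 0 0 = - u 1 0. Proof. by rewrite mxE. Qed.
Lemma perp1E u : perp u 1 0 = u 0 0. Proof. by rewrite mxE. Qed.

Definition perpE := (perp0E, perp1E).

Lemma dotp_perp u : dotp u (perp u) = 0.
Proof. by rewrite /dotp !perpE; ring. Qed.

Lemma perp_eq0 u : (perp u == 0) = (u == 0).
Proof.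
apply/eqP/eqP => [/colP h | ->]; last by apply: colP2; rewrite perpE !mxE ?oppr0.
apply: colP2; rewrite mxE.
  by have := h 1; rewrite perpE mxE.
by have /eqP := h 0; rewrite perpE mxE oppr_eq0 => /eqP.
Qed.

(** The kernel of a nonzero linear form on the plane is a line. Hence a factor of a point of T = 0
    is recovered, up to scale, as [perp] of its slice when that slice is nonzero. *)
Lemma dotp_eq0_scaled s p : s != 0 -> p != 0 -> dotp s p = 0 -> scaled (perp s) p.
Proof.
move=> s0 p0 sp.
have e : s 0 0 * p 0 0 = - (s 1 0 * p 1 0) by apply/eqP; rewrite -addr_eq0; apply/eqP.
have [c ec] : exists c, perp s = c *: p.
  case/vec2_neq0: p0 => p0.
    exists (- s 1 0 / p 0 0); apply: colP2; rewrite perpE mxE ?divfK //.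
    by apply: (mulfI p0); rewrite mulrC e; field.
  exists (s 0 0 / p 1 0); apply: colP2; rewrite perpE mxE ?divfK //.
  by apply: (mulfI p0); rewrite mulrN mulrC -e; field.
exists c => //; apply: contraNneq s0 => c0.
by rewrite -perp_eq0 ec c0 scale0r.
Qed.

Lemma complement u : u != 0 -> exists u', dotp (perp u) u' = 1.
Proof.
case/vec2_neq0 => u0.
  exists (\col_a (if a == 0 then 0 else (u 0 0)^-1)).
  by rewrite /dotp !perpE !mxE /=; field.
exists (\col_a (if a == 0 then - (u 1 0)^-1 else 0)).
by rewrite /dotp !perpE !mxE /=; field.
Qed.

(** Cramer's rule in a basis of determinant 1. *)
Lemma decompose u u' p : dotp (perp u) u' = 1 ->
  p = dotp (perp p) u' *: u + dotp (perp u) p *: u'.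
Proof.
move=> uu'; rewrite -[LHS]scale1r -uu'.
by apply: colP2; rewrite !mxE /dotp !perpE; ring.
Qed.

Implicit Type T : 'I_2 -> 'I_2 -> 'I_2 -> K.

Definition slice1 T v w : 'cV[K]_2 :=
  \col_a \sum_b \sum_c T a b c * v b 0 * w c 0.
Definition slice2 T u w : 'cV[K]_2 :=
  \col_b \sum_a \sum_c T a b c * u a 0 * w c 0.
Definition slice3 T u v : 'cV[K]_2 :=
  \col_c \sum_a \sum_b T a b c * u a 0 * v b 0.

Definition trilinear T u v w : K :=
  \sum_a \sum_b \sum_c T a b c * u a 0 * v b 0 * w c 0.

Lemma trilinear1 T u v w : trilinear T u v w = dotp (slice1 T v w) u.
Proof. rewrite /trilinear /dotp !mxE !sum_ord2; ring. Qed.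

Lemma trilinear2 T u v w : trilinear T u v w = dotp (slice2 T u w) v.
Proof. rewrite /trilinear /dotp !mxE !sum_ord2; ring. Qed.

Lemma trilinear3 T u v w : trilinear T u v w = dotp (slice3 T u v) w.
Proof. rewrite /trilinear /dotp !mxE !sum_ord2; ring. Qed.

Lemma trilinearZ T x y z u v w :
  trilinear T (x *: u) (y *: v) (z *: w) = x * y * z * trilinear T u v w.
Proof. by rewrite /trilinear !sum_ord2 !mxE; ring. Qed.

Definition blend (t : K) u v : 'cV[K]_2 := (1 - t) *: u + t *: v.

Lemma blend0 u v : blend 0 u v = u.
Proof. by rewrite /blend subr0 scale0r scale1r addr0. Qed.

Lemma blend1 u v : blend 1 u v = v.
Proof. by rewrite /blend subrr scale0r scale1r add0r. Qed.

Lemma blendxx t u : blend t u u = u.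
Proof. by rewrite /blend -scalerDl subrK scale1r. Qed.

Definition bundle (t : K) T S a b c := (1 - t) * T a b c + t * S a b c.

Lemma bundle0 T S : bundle 0 T S = T.
Proof. by do 3!apply: funext => ?; rewrite /bundle; ring. Qed.

Lemma bundle1 T S : bundle 1 T S = S.
Proof. by do 3!apply: funext => ?; rewrite /bundle; ring. Qed.

(** The slices are the partial gradients of the form, so this is smoothness of the hypersurface T =
    0 at the point. *)
Definition smooth T u v w :=
  [\/ slice1 T v w != 0, slice2 T u w != 0 | slice3 T u v != 0].

(* If the point is singular, moving u keeps T = 0; if this never makes the second slice
   nonzero then T(., ., w) = 0 and both u and v can be moved freely. *)
Lemma smooth_direction T u v w : (exists a b c, T a b c != 0) ->
    trilinear T u v w = 0 ->
  exists u' v' w', smooth T u' v' w' /\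
    forall t, trilinear T (blend t u u') (blend t v v') (blend t w w') = 0.
Proof.
move=> [a [b [c Tabc]]] Tuvw.
have [s1|s1] := eqVneq (slice1 T v w) 0; last first.
  by exists u, v, w; split=> [|t]; [constructor 1 | rewrite !blendxx].
case: (pselect (exists x, slice2 T x w != 0)) => [[x sx] | nx].
  exists x, v, w; split=> [|t]; first by constructor 2.
  by rewrite !blendxx trilinear1 s1 /dotp !mxE; ring.
exists (\col_i (i == a)%:R), (\col_i (i == b)%:R), w; split=> [|t].
  constructor 3; apply/cV0Pn; exists c; rewrite mxE.
  rewrite (bigD1 a) //= (bigD1 b) //= !mxE !eqxx !mulr1 !big1 ?addr0 //.
    by move=> i /negPf ia; rewrite big1 // => k _; rewrite !mxE ia mulr0 mul0r.
  by move=> i /negPf ia; rewrite !mxE ia mulr0.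
rewrite blendxx trilinear2 (_ : slice2 _ _ _ = 0) /dotp ?mxE; first by ring.
by apply/eqP/negPn/negP => ne; apply: nx; exists (blend t u (\col_i (i == a)%:R)).
Qed.

Definition pencil_form (s : K) v : K := v 0 0 + s * v 1 0.
(** The form l(u) l(v) l(w) + m(u) m(v) m(w), where l and m are the pencil forms with parameters [s]
    and [s + 1]; the shift by 1 gives them determinant 1. *)
Definition two_cubes (s : K) (a b c : 'I_2) : K :=
  let f r (i : 'I_2) := if i == 0 then 1 else r in
  f s a * f s b * f s c + f (s + 1) a * f (s + 1) b * f (s + 1) c.

(** The vector v = [perp] of the second slice has l(v) = - m(u) m(w) and m(v) = l(u) l(w). The third
    slice is thus l(u) m(u) times l(w) m - m(w) l, and the latter is [perp w]. *)
Lemma slice32_two_cubes (s : K) u w :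
  slice3 (two_cubes s) u (perp (slice2 (two_cubes s) u w)) =
  (pencil_form s u * pencil_form (s + 1) u) *: perp w.
Proof.
by apply: colP2; rewrite !(mxE, sum_ord2) /pencil_form /two_cubes /=; ring.
Qed.

Lemma slice31_two_cubes (s : K) v w :
  slice3 (two_cubes s) (perp (slice1 (two_cubes s) v w)) v =
  (pencil_form s v * pencil_form (s + 1) v) *: perp w.
Proof.
by apply: colP2; rewrite !(mxE, sum_ord2) /pencil_form /two_cubes /=; ring.
Qed.

End PlaneVectors.

(** * Polynomial deformations *)

Section PolynomialFunctions.
Variable K : numFieldType.

Definition polyfun (h : K -> K) := exists p : {poly K}, h = horner p.
(** Truth on a nonempty Zariski open subset of the parameter line. *)
Definition generically (Q : K -> Prop) :=
  exists2 p : {poly K}, p != 0 & forall t, p.[t] != 0 -> Q t.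

Lemma polyfun_cst c : polyfun (fun=> c).
Proof. by exists c%:P; apply: funext => t; rewrite hornerC. Qed.

Lemma polyfun_id : polyfun id.
Proof. by exists 'X; apply: funext => t; rewrite hornerX. Qed.

Lemma polyfunD g h : polyfun g -> polyfun h -> polyfun (fun t => g t + h t).
Proof.
by move=> [p ->] [q ->]; exists (p + q); apply: funext => t; rewrite hornerD.
Qed.

Lemma polyfunN g : polyfun g -> polyfun (fun t => - g t).
Proof. by move=> [p ->]; exists (- p); apply: funext => t; rewrite hornerN. Qed.

Lemma polyfunM g h : polyfun g -> polyfun h -> polyfun (fun t => g t * h t).
Proof.
by move=> [p ->] [q ->]; exists (p * q); apply: funext => t; rewrite hornerM.
Qed.

Lemma polyfunX g k : polyfun g -> polyfun (fun t => g t ^+ k).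
Proof.
by move=> [p ->]; exists (p ^+ k); apply: funext => t; rewrite horner_exp.
Qed.

Lemma polyfun_sum I (r : seq I) (g : I -> K -> K) :
  (forall i, polyfun (g i)) -> polyfun (fun t => \sum_(i <- r) g i t).
Proof.
move=> gp; elim: r => [|i r ih].
  by under eq_fun do rewrite big_nil; apply: polyfun_cst.
by under eq_fun do rewrite big_cons; apply: polyfunD.
Qed.

Lemma polyfun_prod I (r : seq I) (g : I -> K -> K) :
  (forall i, polyfun (g i)) -> polyfun (fun t => \prod_(i <- r) g i t).
Proof.
move=> gp; elim: r => [|i r ih].
  by under eq_fun do rewrite big_nil; apply: polyfun_cst.
by under eq_fun do rewrite big_cons; apply: polyfunM.
Qed.

Lemma polyfun_meval n (f : {mpoly K[n]}) (v : K -> 'I_n -> K) :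
  (forall k, polyfun (v^~ k)) -> polyfun (fun t => f.@[v t]).
Proof.
move=> vp; under eq_fun do rewrite mevalE.
apply: polyfun_sum => m; apply: polyfunM; first exact: polyfun_cst.
by apply: polyfun_prod => k; apply: polyfunX.
Qed.

Lemma generically_neq0 h t0 : polyfun h -> h t0 != 0 -> generically (fun t => h t != 0).
Proof.
by move=> [p ->] pt0; exists p => //; apply: contraNneq pt0 => ->; rewrite horner0.
Qed.

Lemma generically_and Q1 Q2 :
  generically Q1 -> generically Q2 -> generically (fun t => Q1 t /\ Q2 t).
Proof.
move=> [p p0 hp] [q q0 hq]; exists (p * q); first by rewrite mulf_neq0.
by move=> t; rewrite hornerM mulf_eq0 => /norP[/hp ? /hq].
Qed.

Lemma generically_imp (Q1 Q2 : K -> Prop) :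
  (forall t, Q1 t -> Q2 t) -> generically Q1 -> generically Q2.
Proof. by move=> h [p p0 hp]; exists p => // t /hp /h. Qed.

Lemma generically_all (I : finType) (Q : I -> K -> Prop) :
  (forall i, generically (Q i)) -> generically (fun t => forall i, Q i t).
Proof.
case/fin_all_exists2 => p p0 hp; exists (\prod_i p i); first exact/prodf_neq0.
by move=> t; rewrite horner_prod => /prodf_neq0 pt i; apply/hp/pt.
Qed.

Lemma generically_ex Q : generically Q -> exists t, Q t.
Proof.
move=> [p p0 hp]; apply: contrapT => nQ; move/eqP: p0; apply.
(* In characteristic 0 the integers below [size p] are distinct, too many to be all roots of [p]. *)
apply: (@roots_geq_poly_eq0 _ p [seq i%:R | i <- iota 0 (size p)]).
- apply/allP => _ /mapP[i _ ->]; rewrite rootE; apply: contraT => /hp Qi.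
  by case: nQ; exists i%:R.
- by rewrite map_inj_uniq ?iota_uniq //; apply: Num.Theory.mulrIn; rewrite oner_eq0.
- by rewrite size_map size_iota.
Qed.

Lemma polyfun_eq0 h : polyfun h -> generically (fun t => h t = 0) -> forall t, h t = 0.
Proof.
move=> hp h0 t; apply: contrapT => /eqP ht.
have [s [-> /eqP]] := generically_ex (generically_and h0 (generically_neq0 hp ht)).
exact.
Qed.

Definition curve (V : K -> 'cV[K]_2) := forall a, polyfun (fun t => V t a 0).

Lemma curve_cst v : curve (fun=> v).
Proof. by move=> a; apply: polyfun_cst. Qed.

Lemma curve_perp V : curve V -> curve (fun t => perp (V t)).
Proof.
move=> Vc; apply: ord2P.
  by under eq_fun do rewrite perpE; apply: polyfunN.
by under eq_fun do rewrite perpE.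
Qed.

Lemma curve_blend u v : curve (fun t => blend t u v).
Proof.
move=> a; under eq_fun do rewrite !mxE.
by apply: polyfunD; apply: polyfunM; do ?apply: polyfunD; do ?apply: polyfunN;
  (apply: polyfun_cst || apply: polyfun_id).
Qed.

Lemma polyfun_dotp U V : curve U -> curve V -> polyfun (fun t => dotp (U t) (V t)).
Proof. by move=> Uc Vc; apply: polyfunD; apply: polyfunM. Qed.

Lemma generically_vec_neq0 V t0 : curve V -> V t0 != 0 -> generically (fun t => V t != 0).
Proof.
move=> Vc /cV0Pn[a Va]; apply: generically_imp (generically_neq0 (Vc a) Va).
by move=> t Vt; apply/cV0Pn; exists a.
Qed.

Implicit Type F : K -> 'I_2 -> 'I_2 -> 'I_2 -> K.

Definition form_curve F := forall a b c, polyfun (fun t => F t a b c).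

Lemma form_curve_cst T : form_curve (fun=> T).
Proof. by move=> a b c; apply: polyfun_cst. Qed.

Lemma form_curve_bundle T S : form_curve (fun t => bundle t T S).
Proof.
move=> a b c.
by apply: polyfunD; apply: polyfunM; do ?apply: polyfunD; do ?apply: polyfunN;
  (apply: polyfun_cst || apply: polyfun_id).
Qed.

Lemma curve_slice1 F U V : form_curve F -> curve U -> curve V ->
  curve (fun t => slice1 (F t) (U t) (V t)).
Proof.
move=> Fc Uc Vc a; under eq_fun do rewrite mxE.
apply: polyfun_sum => b; apply: polyfun_sum => c.
by apply: polyfunM; [apply: polyfunM; [apply: Fc | apply: Uc] | apply: Vc].
Qed.

Lemma curve_slice2 F U V : form_curve F -> curve U -> curve V ->
  curve (fun t => slice2 (F t) (U t) (V t)).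
Proof.
move=> Fc Uc Vc a; under eq_fun do rewrite mxE.
apply: polyfun_sum => b; apply: polyfun_sum => c.
by apply: polyfunM; [apply: polyfunM; [apply: Fc | apply: Uc] | apply: Vc].
Qed.

Lemma curve_slice3 F U V : form_curve F -> curve U -> curve V ->
  curve (fun t => slice3 (F t) (U t) (V t)).
Proof.
move=> Fc Uc Vc a; under eq_fun do rewrite mxE.
apply: polyfun_sum => b; apply: polyfun_sum => c.
by apply: polyfunM; [apply: polyfunM; [apply: Fc | apply: Uc] | apply: Vc].
Qed.

End PolynomialFunctions.

(** * Evaluation of multihomogeneous polynomials *)

Section MultihomogeneousEvaluation.
Variables (K : numFieldType) (n : nat).
Implicit Types (f : coord_ring K n) (v w : 'I_n -> 'I_3 -> 'cV[K]_2).

Definition flat v (k : 'I_#|var n|) : K :=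
  let: (j, i, a) := enum_val k in v j i a 0.

Lemma coords_flat (P : triples K n) : coords P = flat (fun j i => rep (P j i)).
Proof. by []. Qed.

(** Rescaling the vector at (j, i) by c multiplies every monomial of [f] by c to the power [d j i],
    so the vanishing of [f] depends on the projective points only. *)
Lemma meval_scaled f v w : multihomogeneous f -> (forall j i, scaled (v j i) (w j i)) ->
  f.@[flat v] = 0 -> f.@[flat w] = 0.
Proof.
move=> [d fd] vw.
have /fin_all_exists[c hc] :
    forall j, exists c : 'I_3 -> K, forall i, c i != 0 /\ v j i = c i *: w j i.
  move=> j; apply: (@fin_all_exists _ _ (fun i c => c != 0 /\ v j i = c *: w j i)).
  by move=> i; have [c c0 e] := vw j i; exists c.
suff -> : f.@[flat v] = (\prod_j \prod_i c j i ^+ d j i) * f.@[flat w].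
  move=> /eqP; rewrite mulf_eq0 => /orP[|/eqP//]; apply: contraTeq => _.
  apply/prodf_neq0 => j _; apply/prodf_neq0 => i _.
  by rewrite expf_neq0 //; have [] := hc j i.
rewrite !mevalE big_distrr /= [LHS]big_seq [RHS]big_seq; apply: eq_bigr => m /fd md.
rewrite mulrCA; congr (_ * _).
pose cc (x : var n) := let: (j, i, a) := x in c j i.
transitivity (\prod_k (cc (enum_val k) ^+ m k * flat w k ^+ m k)).
  apply: eq_bigr => k _; rewrite -exprMn /flat /cc; case: (enum_val k) => [[j i] a].
  by have [_ ->] := hc j i; rewrite mxE.
rewrite big_split /=; congr (_ * _).
(* Variables are regrouped by (j, i): the exponents of the two coordinates of one vector add up to
   [d j i]. *)
transitivity (\prod_(x : var n) cc x ^+ m (enum_rank x)).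
  rewrite [RHS](reindex (@enum_val (var n) predT)) /=; last exact/onW_bij/enum_val_bij.
  by apply: eq_bigr => k _; rewrite enum_valK.
transitivity (\prod_(x : 'I_n * 'I_3) \prod_(a < 2) c x.1 x.2 ^+ m (enum_rank (x.1, x.2, a))).
  rewrite (pair_bigA _ (fun x a => c x.1 x.2 ^+ m (enum_rank ((x.1, x.2, a) : var n)))).
  by apply: eq_bigr => -[[j i] a] _.
rewrite [RHS]pair_bigA; apply: eq_bigr => -[j i] _ /=.
by rewrite -md expr_sum.
Qed.

(* The points v j are moved independently, but over a common parameter t, since Q t may
   refer to a deformed form. *)
Lemma meval_specialize f v (Q : K -> 'I_n -> ('I_3 -> 'cV[K]_2) -> Prop) :
    multihomogeneous f ->
    (forall j, exists V : 'I_3 -> K -> 'cV[K]_2,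
      [/\ forall i, curve (V i), forall i, scaled (V i 0) (v j i) &
          generically (fun t => Q t j (V^~ t))]) ->
    (forall t w, (forall j, Q t j (w j)) -> f.@[flat w] = 0) ->
  f.@[flat v] = 0.
Proof.
move=> fm /fin_all_exists[V hV] fQ.
apply: (@meval_scaled f (fun j i => V j i 0)) => //.
  by move=> j i; have [_] := hV j.
apply: (@polyfun_eq0 _ (fun t => f.@[flat (fun j i => V j i t)])).
  apply: polyfun_meval => k; rewrite /flat; case: (enum_val k) => [[j i] a].
  by have [/(_ i a)] := hV j.
have : generically (fun t => forall j, Q t j ((V j)^~ t)).
  by apply: generically_all => j; have [] := hV j.
by apply: generically_imp => t; apply: fQ.
Qed.

End MultihomogeneousEvaluation.

(** * Density of the image *)

Lemma rep_mkproj (K : fieldType) (V : vectType K) (v : V) (v0 : v != 0) :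
  scaled (rep (mkproj v0)) v.
Proof.
have /vlineP[c e] : rep (mkproj v0) \in <[v]>%VS by exact: memv_pick.
exists c => //; apply: contraNneq (rep_neq0 (mkproj v0)) => c0.
by rewrite e c0 scale0r.
Qed.

Section ThreeCameras.
Variable K : comPzRingType.
Implicit Types a b c : 'cV[K]_2.

Definition camera a b c : 'M[K]_(2, 3) := \matrix_(i, k) triple (a i 0) (b i 0) (c i 0) k.
Definition point (x y z : K) : 'cV[K]_3 := \col_k triple x y z k.

Lemma camera_point a b c x y z :
  camera a b c *m point x y z = x *: a + y *: b + z *: c.
Proof.
by apply/colP => i; rewrite !mxE sum_ord3 !mxE /triple /=; ring.
Qed.

End ThreeCameras.

Section ImageIsDense.
Variables (K : numClosedFieldType) (n : nat).
Implicit Types (T S : 'I_2 -> 'I_2 -> 'I_2 -> K) (v : 'I_n -> 'I_3 -> 'cV[K]_2).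

(** The determinant of x M_0 + y M_1 is a binary quadratic form, so it has a nontrivial zero (x, y)
    = u over a closed field; w spans a left kernel there. *)
Lemma slice3_zero T : exists u w, [/\ u != 0, w != 0 & slice3 T u w = 0].
Proof.
pose M a : 'M[K]_2 := \matrix_(b, c) T a b c.
have [x [y [xy0 /eqP/det0P[w w0 wM]]]] :
    exists x y, (x != 0 \/ y != 0) /\ \det (x *: M 0 + y *: M 1) = 0.
  (* If M_1 is singular, take (0, 1); otherwise take (1, - x) with x an eigenvalue of M_0 M_1^-1. *)
  have [M1|] := boolP (M 1 \in unitmx); last first.
    rewrite unitmxE unitfE negbK => /eqP d; exists 0, 1.
    by rewrite scale0r scale1r add0r d oner_eq0; split=> //; right.
  have [//|x /eigenvalueP[w wM w0]] := eigenvalue_closed (M 0 *m invmx (M 1)).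
  exists 1, (- x); rewrite oner_eq0; split; first by left.
  apply/eqP/det0P; exists w => //; rewrite scale1r scaleNr mulmxBr -scalemxAr.
  by rewrite scalemxAl -wM -!mulmxA mulVmx // mulmx1 subrr.
exists (\col_a if a == 0 then x else y), w^T; split; last 1 first.
- apply/colP => c; move/rowP: wM => /(_ c); rewrite !(mxE, sum_ord2) /= => <-; ring.
- by apply/cV0Pn; case: xy0 => ?; [exists 0 | exists 1]; rewrite mxE.
- by rewrite -trmx0 (inj_eq trmx_inj).
Qed.

Definition on_form T (p : 'I_3 -> 'cV[K]_2) :=
  (forall i, p i != 0) /\ trilinear T (p 0) (p 1) (p 2%:R) = 0.

Variable f : coord_ring K n.
Hypotheses (n_gt0 : (0 < n)%N) (f_mh : multihomogeneous f).
Hypothesis f_image : forall P, im_theta K n P -> f.@[coords P] = 0.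

Lemma meval_image (A : 'I_3 -> 'M[K]_(2, 3)) (q : 'I_n -> 'cV[K]_3) :
  (forall j i, A i *m q j != 0) -> f.@[flat (fun j i => A i *m q j)] = 0.
Proof.
move=> Aq0.
(* Since n >= 1 there is a first point, and its nonzero image shows that the camera is nonzero. *)
have A0 i : A i != 0.
  by apply: contraNneq (Aq0 (Ordinal n_gt0) i) => ->; rewrite mul0mx.
have q0 j : q j != 0 by apply: contraNneq (Aq0 j 0) => ->; rewrite mulmx0.
have Aq j i : scaled (rep (mkproj (A0 i)) *m rep (mkproj (q0 j))) (A i *m q j).
  have [c c0 ->] := rep_mkproj (A0 i); have [d d0 ->] := rep_mkproj (q0 j).
  by exists (c * d); rewrite ?mulf_neq0 // -scalemxAl -scalemxAr scalerA.
have dom : theta_dom (fun j => mkproj (q0 j)) (fun i => mkproj (A0 i)).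
  by move=> j i; have [c c0 ->] := Aq j i; rewrite scaler_eq0 negb_or c0 Aq0.
have := f_image (ex_intro _ _ (ex_intro _ _ (ex_intro _ dom erefl))).
rewrite coords_flat; apply: meval_scaled => // j i.
have [c c0 ->] := rep_mkproj (dom j i); have [d d0 ->] := Aq j i.
by exists (c * d); rewrite ?mulf_neq0 // scalerA.
Qed.

(* With T(u, w, .) = 0 the form is the trifocal tensor of three explicit cameras, and
   the point with first coordinates p1, p2 is reconstructed by
   q = ([p1,u'][w,p2], [u,p1][p2,w'], [u,p1][w,p2]). *)
Lemma meval_general T u w v : slice3 T u w = 0 ->
    u != 0 -> w != 0 ->
    (forall j, on_form T (v j) /\ [/\ slice3 T (v j 0) (v j 1) != 0,
       dotp (perp u) (v j 0) != 0 & dotp (perp w) (v j 1) != 0]) ->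
  f.@[flat v] = 0.
Proof.
move=> Tuw /complement[u' uu'] /complement[w' ww'] hv.
(* On q = (x, y, z) the first two cameras give x u + z u' and y w + z w'. The third slice at these
   two vectors is divisible by z because T(u, w, .) = 0; the quotient is linear in q, and its [perp]
   is the third camera. *)
pose A := triple (camera u 0 u') (camera 0 w w')
  (camera (perp (slice3 T u w')) (perp (slice3 T u' w)) (perp (slice3 T u' w'))).
pose q j : 'cV[K]_3 := point (dotp (perp (v j 0)) u' * dotp (perp w) (v j 1))
  (dotp (perp u) (v j 0) * dotp (perp (v j 1)) w')
  (dotp (perp u) (v j 0) * dotp (perp w) (v j 1)).
have Aq j i : scaled (A i *m q j) (v j i).
  have [[v0 Tv] [s0 vu vw]] := hv j.
  move: i; apply: ord3P; rewrite /A /= camera_point.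
  - exists (dotp (perp w) (v j 1)) => //.
    rewrite scaler0 addr0 [in RHS](decompose (v j 0) uu').
    by rewrite scalerDr !scalerA mulrC [X in _ + X *: _]mulrC.
  - exists (dotp (perp u) (v j 0)) => //.
    by rewrite scaler0 add0r [in RHS](decompose (v j 1) ww') scalerDr !scalerA.
  rewrite (_ : _ + _ = perp (slice3 T (v j 0) (v j 1))).
    by apply: dotp_eq0_scaled; rewrite -?trilinear3.
  rewrite [in RHS](decompose (v j 0) uu') [in RHS](decompose (v j 1) ww').
  move: (dotp (perp u) _) (dotp _ u') (dotp (perp w) _) (dotp _ w') => z1 s z2 r.
  (* The zero term in T(u, w, .) completes the bilinear expansion of the third slice. *)
  apply: (@eq_trans _ _ (perp (s * r *: slice3 T u w + (s * z2 *: slice3 T u w' +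
    z1 * r *: slice3 T u' w + z1 * z2 *: slice3 T u' w')))).
    by rewrite Tuw scaler0 add0r; apply: colP2; rewrite !(perpE, mxE); ring.
  by congr perp; apply: colP2; rewrite !(mxE, sum_ord2); ring.
apply: (@meval_scaled _ _ f (fun j i => A i *m q j)) => //.
apply: meval_image => j i; have [c c0 ->] := Aq j i.
by have [[v0 _] _] := hv j; rewrite scaler_eq0 negb_or c0 v0.
Qed.

(** The first two factors move on segments towards [u'] and [w'], and the third follows as [perp] of
    the third slice. The brackets with u and w equal 1 at t = 1; the other conditions hold at t =
    0. *)
Lemma meval_slice3 T v :
  (forall j, on_form T (v j) /\ slice3 T (v j 0) (v j 1) != 0) -> f.@[flat v] = 0.
Proof.
move=> hv; have [u [w [u0 w0 Tuw]]] := slice3_zero T.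
apply: (meval_specialize (Q := fun _ _ p => on_form T p /\ [/\ slice3 T (p 0) (p 1) != 0,
  dotp (perp u) (p 0) != 0 & dotp (perp w) (p 1) != 0])) => //; last first.
  by move=> _ p; apply: meval_general.
move=> j; have [[v0 Tv] s0] := hv j.
have [[u' uu'] [w' ww']] := (complement u0, complement w0).
pose V0 t := blend t (v j 0) u'; pose V1 t := blend t (v j 1) w'.
pose V2 t := perp (slice3 T (V0 t) (V1 t)).
have cV0 : curve V0 by apply: curve_blend.
have cV1 : curve V1 by apply: curve_blend.
have cS : curve (fun t => slice3 T (V0 t) (V1 t)).
  by apply: (curve_slice3 (form_curve_cst T)).
exists (triple V0 V1 V2); split.
- by apply: ord3P => //; apply: curve_perp.
- apply: ord3P; rewrite /triple /= /V2 /V0 /V1 ?blend0; do ?exact: scaled_refl.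
  by apply: dotp_eq0_scaled; rewrite -?trilinear3.
have g0 : generically (fun t => V0 t != 0).
  by apply: (generically_vec_neq0 (t0 := 0)); rewrite // /V0 blend0.
have g1 : generically (fun t => V1 t != 0).
  by apply: (generically_vec_neq0 (t0 := 0)); rewrite // /V1 blend0.
have g2 : generically (fun t => slice3 T (V0 t) (V1 t) != 0).
  by apply: (generically_vec_neq0 (t0 := 0)); rewrite // /V0 /V1 !blend0.
have g3 : generically (fun t => dotp (perp u) (V0 t) != 0).
  apply: (generically_neq0 (t0 := 1)); last by rewrite /V0 blend1 uu' oner_eq0.
  exact: (polyfun_dotp (curve_cst _)).
have g4 : generically (fun t => dotp (perp w) (V1 t) != 0).
  apply: (generically_neq0 (t0 := 1)); last by rewrite /V1 blend1 ww' oner_eq0.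
  exact: (polyfun_dotp (curve_cst _)).
have := generically_and g0 (generically_and g1 (generically_and g2 (generically_and g3 g4))).
apply: generically_imp => t [a [b [c [d e]]]]; split=> //; split.
  by apply: ord3P; rewrite /triple //= perp_eq0.
by rewrite trilinear3 dotp_perp.
Qed.

(** For a fixed nonzero vector, each pencil form is a nonzero polynomial in s, so only finitely many
    s are excluded. *)
Lemma avoiding_pencil (p : 'I_n -> 'I_3 -> 'cV[K]_2) : (forall j i, p j i != 0) ->
  exists s, forall j i, pencil_form s (p j i) * pencil_form (s + 1) (p j i) != 0.
Proof.
move=> p0; apply: generically_ex.
apply: generically_all => j; apply: generically_all => i.
have pf (x : K) : polyfun (fun s => pencil_form (s + x) (p j i)).
  apply: polyfunD; first exact: polyfun_cst.
  apply: polyfunM; last exact: polyfun_cst.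
  by apply: polyfunD; [apply: polyfun_id | apply: polyfun_cst].
have gx (x : K) : generically (fun s => pencil_form (s + x) (p j i) != 0).
  have [p00|p00] := eqVneq (p j i 0 0) 0; last first.
    apply: (generically_neq0 (t0 := - x)) => //.
    by rewrite /pencil_form addNr mul0r addr0.
  apply: (generically_neq0 (t0 := 1 - x)) => //.
  rewrite /pencil_form subrK mul1r p00 add0r.
  by case/vec2_neq0: (p0 j i) => //; rewrite p00 eqxx.
have := generically_and (gx 0) (gx 1).
by apply: generically_imp => s [a b]; rewrite mulf_neq0 // -[s]addr0.
Qed.

(* Deforming T to a sum of two cubes l^3 + m^3 makes every smooth point the limit of
   points whose third slice does not vanish. *)
Lemma meval_smooth T v :
    (forall j, on_form T (v j) /\ smooth T (v j 0) (v j 1) (v j 2%:R)) ->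
  f.@[flat v] = 0.
Proof.
move=> hv; have [s hs] : exists s, forall j i,
    pencil_form s (v j i) * pencil_form (s + 1) (v j i) != 0.
  by apply: avoiding_pencil => j; have [[]] := hv j.
pose F t := bundle t T (two_cubes s).
apply: (meval_specialize (Q := fun t _ p => on_form (F t) p /\
  slice3 (F t) (p 0) (p 1) != 0)) => //; last by move=> t p; apply: meval_slice3.
have cF : form_curve F by apply: form_curve_bundle.
move=> j; have [[v0 Tv] sm] := hv j.
have pw0 k i : pencil_form s (v j i) * pencil_form (s + 1) (v j i) *: perp (v j k) != 0.
  by rewrite scaler_eq0 negb_or hs perp_eq0 v0.
(* The factor with nonzero slice becomes [perp] of its slice in [F t]. At t = 0 this is the given
   point; in the first two cases the third slice is nonzero at t = 1 by the two-cube identities. *)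
case: sm => s0.
- pose S t := slice1 (F t) (v j 1) (v j 2%:R).
  have cS : curve S by apply: curve_slice1 => //; apply: curve_cst.
  have S0 : S 0 = slice1 T (v j 1) (v j 2%:R) by rewrite /S /F bundle0.
  exists (triple (fun t => perp (S t)) (fun=> v j 1) (fun=> v j 2%:R)); split.
  + by apply: ord3P; [apply: curve_perp | apply: curve_cst | apply: curve_cst].
  + apply: ord3P; rewrite /triple /=; do ?exact: scaled_refl.
    by rewrite S0; apply: dotp_eq0_scaled; rewrite -?trilinear1.
  have g0 : generically (fun t => S t != 0).
    by apply: (generically_vec_neq0 (t0 := 0)) => //; rewrite S0.
  have g1 : generically (fun t => slice3 (F t) (perp (S t)) (v j 1) != 0).
    apply: (generically_vec_neq0 (t0 := 1)).
      by apply: curve_slice3 => //; [apply: curve_perp | apply: curve_cst].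
    by rewrite /S /F bundle1 slice31_two_cubes.
  have := generically_and g0 g1; apply: generically_imp => t [a b]; split=> //; split.
    by apply: ord3P; rewrite /triple //= perp_eq0.
  by rewrite trilinear1 dotp_perp.
- pose S t := slice2 (F t) (v j 0) (v j 2%:R).
  have cS : curve S by apply: curve_slice2 => //; apply: curve_cst.
  have S0 : S 0 = slice2 T (v j 0) (v j 2%:R) by rewrite /S /F bundle0.
  exists (triple (fun=> v j 0) (fun t => perp (S t)) (fun=> v j 2%:R)); split.
  + by apply: ord3P; [apply: curve_cst | apply: curve_perp | apply: curve_cst].
  + apply: ord3P; rewrite /triple /=; do ?exact: scaled_refl.
    by rewrite S0; apply: dotp_eq0_scaled; rewrite -?trilinear2.
  have g0 : generically (fun t => S t != 0).
    by apply: (generically_vec_neq0 (t0 := 0)) => //; rewrite S0.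
  have g1 : generically (fun t => slice3 (F t) (v j 0) (perp (S t)) != 0).
    apply: (generically_vec_neq0 (t0 := 1)).
      by apply: curve_slice3 => //; [apply: curve_cst | apply: curve_perp].
    by rewrite /S /F bundle1 slice32_two_cubes.
  have := generically_and g0 g1; apply: generically_imp => t [a b]; split=> //; split.
    by apply: ord3P; rewrite /triple //= perp_eq0.
  by rewrite trilinear2 dotp_perp.
(* In this last case the third slice is already nonzero at t = 0. *)
pose S t := slice3 (F t) (v j 0) (v j 1).
have cS : curve S by apply: curve_slice3 => //; apply: curve_cst.
have S0 : S 0 = slice3 T (v j 0) (v j 1) by rewrite /S /F bundle0.
exists (triple (fun=> v j 0) (fun=> v j 1) (fun t => perp (S t))); split.
- by apply: ord3P; [apply: curve_cst | apply: curve_cst | apply: curve_perp].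
- apply: ord3P; rewrite /triple /=; do ?exact: scaled_refl.
  by rewrite S0; apply: dotp_eq0_scaled; rewrite -?trilinear3.
have g0 : generically (fun t => S t != 0).
  by apply: (generically_vec_neq0 (t0 := 0)) => //; rewrite S0.
move: g0; apply: generically_imp => t a; split=> //; split.
  by apply: ord3P; rewrite /triple //= perp_eq0.
by rewrite trilinear3 dotp_perp.
Qed.

(** The segments of [smooth_direction] stay on T = 0. Smoothness is an open condition that holds at
    their end t = 1, hence at a general t. *)
Lemma meval_on_form T v : (exists a b c, T a b c != 0) ->
  (forall j, on_form T (v j)) -> f.@[flat v] = 0.
Proof.
move=> T0 hv.
apply: (meval_specialize (Q := fun _ _ p => on_form T p /\
  smooth T (p 0) (p 1) (p 2%:R))) => //; last by move=> _ p; apply: meval_smooth.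
move=> j; have [v0 Tv] := hv j; have [x [y [z [sm on]]]] := smooth_direction T0 Tv.
pose r := triple x y z; pose V i t := blend t (v j i) (r i).
have cV i : curve (V i) by apply: curve_blend.
have cT := form_curve_cst T.
exists V; split=> // [i|]; first by rewrite /V blend0; apply: scaled_refl.
have g0 : generically (fun t => forall i, V i t != 0).
  apply: generically_all => i; apply: (generically_vec_neq0 (t0 := 0)) => //.
  by rewrite /V blend0.
have g1 : generically (fun t => smooth T (V 0 t) (V 1 t) (V 2%:R t)).
  case: sm => sm.
  - apply: (generically_imp (Q1 := fun t => slice1 T (V 1 t) (V 2%:R t) != 0)).
      by move=> t; constructor 1.
    by apply: (generically_vec_neq0 (t0 := 1)); [apply: curve_slice1 | rewrite /V !blend1].
  - apply: (generically_imp (Q1 := fun t => slice2 T (V 0 t) (V 2%:R t) != 0)).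
      by move=> t; constructor 2.
    by apply: (generically_vec_neq0 (t0 := 1)); [apply: curve_slice2 | rewrite /V !blend1].
  apply: (generically_imp (Q1 := fun t => slice3 T (V 0 t) (V 1 t) != 0)).
    by move=> t; constructor 3.
  by apply: (generically_vec_neq0 (t0 := 1)); [apply: curve_slice3 | rewrite /V !blend1].
have := generically_and g0 g1; apply: generically_imp => t [a b].
by split=> //; split=> //; apply: on.
Qed.

End ImageIsDense.

(** * The hyperplane of three cameras *)

Section CameraForm.
Variable K : fieldType.
Implicit Types (a b u v : 'cV[K]_2) (T : 'I_2 -> 'I_2 -> 'I_2 -> K).

(** With z = a.u = b.v, x = a'.u and y = b'.v, this array represents z (r_0 x + r_1 y + r_2 z). *)
Definition bilinear_form a a' b b' (r : 'rV[K]_3) (i j : 'I_2) : K :=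
  r 0 0 * a' i 0 * b j 0 + r 0 1 * a i 0 * b' j 0 + r 0 2%:R * a i 0 * b j 0.

Lemma bilinear_form_neq0 a a' b b' r :
    dotp (perp a) a' = 1 -> dotp (perp b) b' = 1 -> r != 0 ->
  exists i j, bilinear_form a a' b b' r i j != 0.
Proof.
move=> aa' bb'; apply: contraNP => nD.
pose B u v := \sum_i \sum_j bilinear_form a a' b b' r i j * u i 0 * v j 0.
have B0 u v : B u v = 0.
  apply: big1 => i _; apply: big1 => j _.
  suff -> : bilinear_form a a' b b' r i j = 0 by rewrite !mul0r.
  by apply/eqP/negPn/negP => D; apply: nD; exists i, j.
(* Evaluating at [perp] of the basis vectors, which are dual bases up to sign, isolates each entry
   of r. *)
apply/eqP/rowP; apply: ord3P; rewrite mxE.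
- rewrite -[LHS]mulr1 -{1}aa' -[LHS]mulr1 -{1}bb' -[RHS]oppr0 -(B0 (perp a) (perp b')).
  by rewrite /B /bilinear_form /dotp !sum_ord2 !perpE; ring.
- rewrite -[LHS]mulr1 -{1}aa' -[LHS]mulr1 -{1}bb' -[RHS]oppr0 -(B0 (perp a') (perp b)).
  by rewrite /B /bilinear_form /dotp !sum_ord2 !perpE; ring.
rewrite -[LHS]mulr1 -{1}aa' -[LHS]mulr1 -{1}bb' -(B0 (perp a') (perp b')).
by rewrite /B /bilinear_form /dotp !sum_ord2 !perpE; ring.
Qed.

(** Stacking the two matrices gives four rows in a space of dimension 3, hence a linear relation. *)
Lemma common_row (A0 A1 : 'M[K]_(2, 3)) :
  exists a b, (a != 0 \/ b != 0) /\ a^T *m A0 = b^T *m A1.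
Proof.
have : kermx (col_mx A0 A1) != 0.
  rewrite kermx_eq0; apply/negP => /eqP h.
  by have := rank_leq_col (col_mx A0 A1); rewrite h.
case/rowV0Pn => k /sub_kermxP; rewrite -[k]hsubmxK mul_row_col => e k0.
exists (lsubmx k)^T, (- rsubmx k)^T; rewrite !trmxK; split; last first.
  by apply/eqP; rewrite mulNmx -addr_eq0 e.
have [l0|l0] := eqVneq (lsubmx k) 0; [right | left].
  rewrite -trmx0 (inj_eq trmx_inj) oppr_eq0.
  by apply: contraNneq k0 => ->; rewrite l0 row_mx0.
by rewrite -trmx0 (inj_eq trmx_inj).
Qed.

Lemma dotpE u m (A : 'M[K]_(2, m)) (q : 'cV[K]_m) : dotp u (A *m q) = (u^T *m A *m q) 0 0.
Proof. by rewrite -mulmxA [RHS]mxE sum_ord2 ![u^T _ _]mxE. Qed.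

(* If a A0 = b A1 = z, the three cameras factor through the coordinates x, y, z of q, in
   which all products of z with a quadratic form in x, y, z are forms in the images. *)
Lemma camera_form (A : 'I_3 -> 'M[K]_(2, 3)) : (forall i, A i != 0) ->
  exists2 T, (exists i j k, T i j k != 0) &
    forall q, trilinear T (A 0 *m q) (A 1 *m q) (A 2%:R *m q) = 0.
Proof.
move=> A0; have [a [b [ab e]]] := common_row (A 0) (A 1).
have eq_dotp q : dotp a (A 0 *m q) = dotp b (A 1 *m q) by rewrite !dotpE e.
(* If z = 0, a linear form in one image vanishes identically; constant coefficients in the other two
   factors make it trilinear. *)
have [z0|z0] := eqVneq (a^T *m A 0) 0.
  have da q : dotp a (A 0 *m q) = 0 by rewrite dotpE z0 mul0mx mxE.
  case: ab => /cV0Pn[i hi].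
    exists (fun k _ _ => a k 0) => [|q]; first by exists i, 0, 0.
    have := da q; move: (A 0 *m q) (A 1 *m q) (A 2%:R *m q) => u v w au.
    transitivity (dotp a u * (v 0 0 + v 1 0) * (w 0 0 + w 1 0)).
      by rewrite /trilinear /dotp !sum_ord2; ring.
    by rewrite au !mul0r.
  exists (fun _ k _ => b k 0) => [|q]; first by exists 0, i, 0.
  have := da q; rewrite eq_dotp; move: (A 0 *m q) (A 1 *m q) (A 2%:R *m q) => u v w bv.
  transitivity (dotp b v * (u 0 0 + u 1 0) * (w 0 0 + w 1 0)).
    by rewrite /trilinear /dotp !sum_ord2; ring.
  by rewrite bv !mul0r.
have a0 : a != 0 by apply: contraNneq z0 => ->; rewrite trmx0 mul0mx.
have b0 : b != 0 by apply: contraNneq z0; rewrite e => ->; rewrite trmx0 mul0mx.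
have [[a' aa'] [b' bb']] := (complement a0, complement b0).
pose D := bilinear_form a a' b b'.
(* The rows of [M] are the linear forms x, y, z in q. *)
pose M : 'M[K]_3 := \matrix_k triple (a'^T *m A 0) (b'^T *m A 1) (a^T *m A 0) k.
have DM r q : \sum_i \sum_j D r i j * (A 0 *m q) i 0 * (A 1 *m q) j 0 =
    dotp a (A 0 *m q) * (r *m M *m q) 0 0.
  have Mq k : (M *m q) k 0 = triple (dotp a' (A 0 *m q)) (dotp b' (A 1 *m q))
      (dotp a (A 0 *m q)) k.
    rewrite (_ : (M *m q) k 0 = row k (M *m q) 0 0); last by rewrite [RHS]mxE.
    by rewrite row_mul rowK !dotpE; move: k; apply: ord3P; rewrite /triple.
  rewrite -mulmxA [in RHS]mxE sum_ord3 !Mq /triple /= !sum_ord2 /D /bilinear_form.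
  have := eq_dotp q; move: (A 0 *m q) (A 1 *m q) => u v.
  set d := dotp a u => ed.
  transitivity (r 0 0 * dotp a' u * dotp b v + r 0 1 * d * dotp b' v + r 0 2%:R * d * dotp b v).
    by rewrite /d /dotp; ring.
  by rewrite -ed; ring.
(* If x, y, z satisfy a linear relation r, then z times that relation is a form in the first two
   images alone. *)
have [uM|] := boolP (M \in unitmx); last first.
  rewrite unitmxE unitfE negbK => /det0P[r r0 rM].
  have [i [j Dij]] := bilinear_form_neq0 aa' bb' r0.
  exists (fun i j _ => D r i j) => [|q]; first by exists i, j, 0.
  have := DM r q; rewrite rM mul0mx mxE mulr0 /trilinear !sum_ord2.
  move: (A 0 *m q) (A 1 *m q) (A 2%:R *m q) => u v w h.
  rewrite -[RHS](mulr0 (w 0 0 + w 1 0)) -h; ring.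
pose C := A 2%:R *m invmx M.
have CM : C *m M = A 2%:R by rewrite /C mulmxKV.
have rCM k q : (row k C *m M *m q) 0 0 = (A 2%:R *m q) k 0.
  by rewrite -row_mul CM -row_mul mxE.
(* Both coordinates of w = A_2 q are combinations of x, y, z, so z w_0 and z w_1 are bilinear in the
   first two images, and the form is (z w_1) w_0 - (z w_0) w_1. *)
exists (fun i j k => if k == 0 then D (row 1 C) i j else - D (row 0 C) i j) => [|q].
  have [k rk] : exists k, row k C != 0.
    have : C != 0 by apply: contraNneq (A0 2%:R); rewrite -CM => ->; rewrite mul0mx.
    by case/matrix0Pn => k [l hl]; exists k; apply/rV0Pn; exists l; rewrite mxE.
  have [i [j Dij]] := bilinear_form_neq0 aa' bb' rk.
  move: k rk Dij; apply: ord2P => rk Dij.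
    by exists i, j, 1; rewrite /= oppr_eq0.
  by exists i, j, 0.
have := DM (row 1 C) q; have := DM (row 0 C) q; rewrite !rCM /trilinear !sum_ord2 /=.
move: (A 0 *m q) (A 1 *m q) (A 2%:R *m q) => u v w h0 h1.
transitivity ((dotp a u * w 1 0) * w 0 0 - (dotp a u * w 0 0) * w 1 0); last by ring.
by rewrite -h0 -h1; ring.
Qed.

End CameraForm.

(** * Hyperplanes of tensors and trilinear forms *)

Section Hyperplanes.
Variable K : fieldType.
Implicit Types (T : 'I_2 -> 'I_2 -> 'I_2 -> K) (x : tensor K).

Definition pairing T x : K^o := \sum_t T t.1.1 t.1.2 t.2 * x t.

Fact pairing_is_linear T : linear (pairing T).
Proof.
move=> k x y; rewrite /pairing scaler_sumr -big_split; apply: eq_bigr => t _.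
rewrite !ffunE /GRing.scale /=; ring.
Qed.

HB.instance Definition _ T :=
  GRing.isLinear.Build K (tensor K) K^o *:%R (pairing T) (pairing_is_linear T).

Lemma pairing_tensor3 T (u v w : 'cV[K]_2) : pairing T (tensor3 u v w) = trilinear T u v w.
Proof.
rewrite /trilinear pair_bigA pair_bigA; apply: eq_bigr => t _.
by rewrite ffunE !mulrA.
Qed.

Definition basis_tensor (t : 'I_2 * 'I_2 * 'I_2) : tensor K := [ffun s => (s == t)%:R].

Lemma tensor_expand x : x = \sum_t x t *: basis_tensor t.
Proof.
apply/ffunP => s; rewrite sum_ffunE (bigD1 s) //= !ffunE eqxx big1 => [|t ts].
  by rewrite addr0; exact/esym/mulr1.
by rewrite !ffunE eq_sym (negPf ts); exact: mulr0.
Qed.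

Lemma pairing_basis T t : pairing T (basis_tensor t) = T t.1.1 t.1.2 t.2.
Proof.
rewrite /pairing (bigD1 t) //= ffunE eqxx mulr1 big1 ?addr0 // => s st.
by rewrite ffunE (negPf st) mulr0.
Qed.

Lemma hyperplane_of_form T : (exists i j k, T i j k != 0) ->
  exists2 H : {vspace tensor K}, hyperplane H & forall x, (x \in H) = (pairing T x == 0).
Proof.
move=> [a [b [c Tabc]]]; exists (lker (linfun (pairing T))); last first.
  by move=> x; rewrite memv_ker lfunE.
rewrite /hyperplane -(limg_ker_dim (linfun (pairing T)) fullv) capfv -addn1.
congr (_ + _)%N; apply/eqP; rewrite eqn_leq lt0n dimv_eq0; apply/andP; split.
  apply: contraNneq Tabc => l0; rewrite -[T a b c](pairing_basis T (a, b, c)).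
  rewrite -[pairing _ _](lfunE (pairing T)).
  have := memv_img (linfun (pairing T)) (memvf (basis_tensor (a, b, c))).
  by rewrite l0 memv0.
by rewrite -[1%N]/(dim K^o) -dimvf dimvS ?subvf.
Qed.

(** The map x - [projv H x] kills H and is nonzero at some e outside H; a coordinate that is nonzero
    at e gives the form. *)
Lemma form_of_hyperplane (H : {vspace tensor K}) : hyperplane H ->
  exists2 T, (exists i j k, T i j k != 0) & forall x, x \in H -> pairing T x = 0.
Proof.
move=> hH; have /subvPn[e _ eH] : ~~ (fullv <= H)%VS.
  by apply/negP => /dimvS; rewrite -hH ltnn.
have [t et] : exists t, (e - projv H e) t != 0.
  apply: contrapT => nt; case/negP: eH; rewrite (_ : e = projv H e) ?memv_proj //.
  apply/eqP; rewrite -subr_eq0; apply/eqP/ffunP => t; rewrite [RHS]ffunE.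
  by apply/eqP/negPn/negP => et; apply: nt; exists t.
pose psi s := (basis_tensor s - projv H (basis_tensor s)) t.
pose T a b c := psi (a, b, c).
have TE x : pairing T x = (x - projv H x) t.
  rewrite {2 3}[x]tensor_expand linear_sum -sumrB sum_ffunE; apply: eq_bigr => -[[a b] c] _.
  by rewrite linearZ -scalerBr [RHS]ffunE mulrC.
exists T => [|x xH]; last by rewrite TE projv_id // subrr ffunE.
apply: contrapT => nT; move: et; rewrite -TE /pairing big1 ?eqxx // => -[[a b] c] _ /=.
suff -> : T a b c = 0 by rewrite mul0r.
by apply/eqP/negPn/negP => ?; apply: nT; exists a, b, c.
Qed.

End Hyperplanes.

(** * Comparison of the two closures *)

Lemma smallest_eq (U : Type) (C : set U -> Prop) (X Y : set U) :
  (forall Z, C Z -> X `<=` Z <-> Y `<=` Z) -> smallest C X = smallest C Y.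
Proof.
by move=> h; apply/seteqP; split=> x hx Z [CZ ?]; apply: hx; split=> //; apply/(h Z CZ).
Qed.

Lemma segre_subv (K : fieldType) (p : 'I_3 -> P1 K) (H : {vspace tensor K}) :
  (segre p <= H)%VS = (tensor3 (rep (p 0)) (rep (p 1)) (rep (p 2%:R)) \in H).
Proof. by rewrite memvE. Qed.

Lemma im_theta_hyperplane (K : fieldType) (n : nat) (P : triples K n) :
  im_theta K n P ->
  exists2 H : {vspace tensor K}, hyperplane H & forall j, (segre (P j) <= H)%VS.
Proof.
move=> [q [A [qA ->]]].
have [T T0 TA] := camera_form (fun i => rep_neq0 (A i)).
have [H hH HE] := hyperplane_of_form T0; exists H => // j.
rewrite segre_subv HE pairing_tensor3 /theta.
have [x _ ->] := rep_mkproj (qA j 0); have [y _ ->] := rep_mkproj (qA j 1).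
by have [z _ ->] := rep_mkproj (qA j 2%:R); rewrite trilinearZ TA mulr0.
Qed.

Theorem theorem4p5 (R : realType) (n : nat) (hn : (1 <= n)%N) :
  zariski_closure (im_theta R[i] n) = seg_locus R[i] n.
Proof.
(* It suffices that a zero locus contains the image iff it contains all hyperplane configurations:
   density gives one direction, the camera form the other. *)
apply: smallest_eq => _ [S Smh ->]; split=> [imS P [H hH PH] f Sf | segS P /im_theta_hyperplane].
  have [T T0 TH] := form_of_hyperplane hH.
  rewrite coords_flat; apply: (meval_on_form hn (Smh f Sf) _ T0) => [Q /imS|j].
    exact.
  split=> [i|]; first exact: rep_neq0.
  by rewrite -pairing_tensor3 TH // -segre_subv.
exact: segS.
Qed.
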